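(* Let $G$ be the directed graph of a structured system of $M$ equations in $N$ variables, let $S=S(G)$ be its $M\times N$ structure matrix, let $T=S^{T}$ (the $N\times M$ transposed structure matrix), and let $r=\operatorname{maxrank}(S)=\operatorname{maxrank}(T)$. Then: (I) $r<M$ if and only if there is a backward $K$-bottleneck in $G$ for some $K>0$. If so, there exists a unique minimax backward bottleneck, and it is a backward $K^*$-bottleneck with $K^*=M-r$. (II) The bottle of the minimax backward bottleneck of $G$ is the set $B_{\rm kernel}$ of kernel nodes of $T$. (III) The graph $G$ is fragile if and only if there is a backward bottleneck in $G$.
   Context: Structured systems and graphs. A structured system of $M$ equations $f_i(x_1,\dots,x_N)=c_i$ ($1\le i\le M$) in $N$ variables specifies, for each $i$, which variables $x_j$ are allowed to appear in $f_i$. It is represented by a directed graph $G$ with nodes $1,\dots,P$, $P=\max\{M,N\}$ (self-edges allowed), having an edge from node $j$ to node $i$ exactly when variable $j$ is allowed to appear in $f_i$. A node with an incoming edge is called a function node and a node with an outgoing edge is called a variable node. Standing assumption: every node has at least one incoming or at least one outgoing edge; node $i$ has an incoming edge if and only if $i\le M$, and node $j$ has an outgoing edge if and only if $j\le N$. Thus the set of function nodes is $G_f=\{1,\dots,M\}$ and the set of variable nodes is $G_x=\{1,\dots,N\}$. Structure matrix. The structure matrix $S(G)$ is the $M\times N$ zero pattern whose $(i,j)$ entry is allowed to be nonzero if and only if $G$ has an edge from node $j$ to node $i$; all other entries are $0$. A real matrix $A$ of the same size as a structure matrix $S$ respects $S$ if $A_{ij}=0$ whenever $S_{ij}=0$.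 The matrices respecting $S$ form a finite-dimensional real vector space $\mathcal L(S)$ (identified with the linear maps $x\mapsto Ax$), and ''almost every $A\in\mathcal L(S)$'' refers to Lebesgue measure on this space. $\operatorname{maxrank}(S)$ is the maximal rank of all matrices respecting $S$. The transpose $T=S^T$ is the transposed pattern, so that $\mathcal L(T)=\{A^T: A\in\mathcal L(S)\}$. Fragile graph. $G$ is called fragile if $\operatorname{maxrank}(S(G))<M$. Backward bottlenecks. For a set $B$ of nodes, the backward set $B^{\leftarrow}$ is the set of all nodes $g$ of $G$ for which there is an edge starting at $g$ and ending at a node in $B$. For $K>0$, a pair $(B,B^{\leftarrow})$ with $B\subset G_f$ is a backward $K$-bottleneck if $B$ has exactly $K$ nodes more than $B^{\leftarrow}$ (the two sets may overlap). A backward bottleneck is a backward $K$-bottleneck for some integer $K>0$. The set $B$ is called the bottle and $B^{\leftarrow}$ the neck. Let $K_{\max}$ be the largest $K$ for which there is a backward $K$-bottleneck. A minimax backward bottleneck is a backward $K_{\max}$-bottleneck $(B,B^{\leftarrow})$ for which $B$ has the minimum number of nodes among all backward $K_{\max}$-bottlenecks. Kernel nodes. For a structure matrix with $n$ columns, a coordinate (node) $j\in\{1,\dots,n\}$ is a kernel node if, for almost every matrix $A$ respecting the structure matrix, there is a vector $x\in\ker A$ with $x_j\neq 0$. In particular the kernel nodes of $T$ form a subset of $\{1,\dots,M\}$. *)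

(* Defs.v *)
From HB Require Import structures.
From mathcomp Require Import all_boot all_order all_algebra.
From mathcomp Require Import boolp classical_sets functions cardinality reals ereal.
From mathcomp Require Import topology normedtype sequences esum numfun.
From mathcomp Require Import measure lebesgue_measure lebesgue_integral.

Set Implicit Arguments.
Unset Strict Implicit.
Unset Printing Implicit Defensive.

Import Order.TTheory GRing.Theory Num.Theory.
Local Open Scope ring_scope.

Section LebesgueTuple.
Context {R : realType}.
Local Notation RT := (measurableTypeR R).

Definition tuple_cons n (p : RT * n.-tuple RT) : n.+1.-tuple RT :=
  [the n.+1.-tuple RT of p.1 :: p.2].

Lemma measurable_tuple_cons n : measurable_fun setT (@tuple_cons n).
Proof. exact: measurable_cons. Qed.

Section LebesgueCons.
Context {n : nat} (mu : {sigma_finite_measure set (n.-tuple RT) -> \bar R}).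

Definition lebesgue_cons : set (n.+1.-tuple RT) -> \bar R :=
  pushforward (@lebesgue_measure R \x mu)%E (@tuple_cons n).

Let lebesgue_cons0 : lebesgue_cons set0 = 0%E.
Proof. by rewrite /lebesgue_cons /pushforward preimage_set0 measure0. Qed.

Let lebesgue_cons_ge0 A : (0 <= lebesgue_cons A)%E.
Proof. by rewrite /lebesgue_cons /pushforward; exact: measure_ge0. Qed.

Let lebesgue_cons_sigma_additive : semi_sigma_additive lebesgue_cons.
Proof.
have mf A : measurable A -> measurable (@tuple_cons n @^-1` A)%classic.
  by move=> mA; rewrite -[X in measurable X]setTI; exact: measurable_tuple_cons.
move=> F mF tF mUF; rewrite /lebesgue_cons /pushforward preimage_bigcup.
apply: measure_semi_sigma_additive.
- by move=> k; exact: mf.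
- apply/trivIsetP => /= i j _ _ ij; rewrite -preimage_setI.
  by move/trivIsetP : tF => /(_ _ _ _ _ ij) ->//; rewrite preimage_set0.
- by rewrite -preimage_bigcup; exact: mf.
Qed.

HB.instance Definition _ := isMeasure.Build _ _ _ lebesgue_cons
  lebesgue_cons0 lebesgue_cons_ge0 lebesgue_cons_sigma_additive.

Let lebesgue_cons_sigma_finite : sigma_finite setT lebesgue_cons.
Proof.
have /sigma_finiteP[F [TF ndF Foo]] := sigma_finiteT (@lebesgue_measure R).
have /sigma_finiteP[G [TG ndG Goo]] := sigma_finiteT mu.
pose g (t : n.+1.-tuple RT) : RT * n.-tuple RT :=
  (thead t, [tuple of behead t]).
have gK : cancel (@tuple_cons n) g.
  by move=> [x t]; congr (_, _); apply: val_inj.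
have mg : measurable_fun setT g.
  by apply/measurable_fun_pairP; split; [exact: measurable_tnth|
    exact: measurable_behead].
exists (fun k => g @^-1` (F k `*` G k))%classic.
  rewrite -preimage_bigcup (_ : \bigcup_k _ = setT)%classic ?preimage_setT//.
  apply/seteqP; split=> // -[x y] _.
  have [a _ Fx] : (\bigcup_k F k)%classic x by rewrite -TF.
  have [b _ Gy] : (\bigcup_k G k)%classic y by rewrite -TG.
  exists (maxn a b) => //; split.
    by move: x Fx; exact/subsetPset/ndF/leq_maxl.
  by move: y Gy; exact/subsetPset/ndG/leq_maxr.
move=> k; have [mF Fk] := Foo k; have [mG Gk] := Goo k; split.
  by rewrite -[X in measurable X]setTI; apply: mg => //; exact: measurableX.
rewrite /lebesgue_cons /pushforward -comp_preimage.
rewrite (_ : g \o _ = id); last by apply/funext => p /=; rewrite gK.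
by rewrite preimage_id product_measure1E// lte_mul_pinfty// ge0_fin_numE.
Qed.

HB.instance Definition _ := Measure_isSigmaFinite.Build _ _ _ lebesgue_cons
  lebesgue_cons_sigma_finite.

End LebesgueCons.

(* Lebesgue measure on R^n, as the n-fold product of Lebesgue measure on R. *)
Fixpoint lebesgue_tuple (n : nat) :
    {sigma_finite_measure set (n.-tuple RT) -> \bar R} :=
  match n with
  | 0%N => \d_([tuple] : 0.-tuple RT)
  | m.+1 => lebesgue_cons (lebesgue_tuple m)
  end.

Lemma lebesgue_tuple_box n (B : 'I_n -> set RT) :
  (forall i, measurable (B i)) ->
  lebesgue_tuple n [set t : n.-tuple RT | forall i, B i (tnth t i)]%classic
  = (\prod_(i < n) lebesgue_measure (B i))%E.
Proof.
elim: n B => [|n IH] B mB.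
  by rewrite big_ord0 /= diracE mem_set //; case.
rewrite big_ord_recl /= /lebesgue_cons /pushforward -IH // -product_measure1E //.
- congr (_ _); apply/seteqP; split=> -[x t] /= H.
    by split=> [|i]; [have := H ord0 | have := H (lift ord0 i); rewrite tnthS].
  by case: H => H0 H1 i; case: (unliftP ord0 i) => [j ->|->] //; rewrite tnthS.
- rewrite (_ : mkset _ = \bigcap_(i in [set: 'I_n])
      (@tnth n _ ^~ i @^-1` B (lift ord0 i)))%classic.
    apply: fin_bigcap_measurable => // i _.
    by rewrite -[X in measurable X]setTI; exact: measurable_tnth.
  by apply/seteqP; split=> t /= H i => [_|]; [exact: H|exact: (H i I)].
Qed.

End LebesgueTuple.

Section Patterns.
Local Notation pattern m n := 'M[bool]_(m, n).

(* A zero pattern is a boolean matrix: true marks the entries that are allowed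
   to be nonzero, so that the transposed pattern is the library's S^T. *)
Definition respects (R : realType) m n (S : pattern m n) (A : 'M[R]_(m, n)) :=
  forall i j, ~~ S i j -> A i j = 0.

(* The bound k < m.+1 is harmless: \rank A <= m for A with m rows. *)
Definition maxrank (R : realType) m n (S : pattern m n) : nat :=
  \max_(k < m.+1 | `[< exists2 A : 'M[R]_(m, n), respects S A & \rank A = k >])
    k.

Definition allowed m n (S : pattern m n) : {set 'I_m * 'I_n} :=
  [set p | S p.1 p.2].

(* The linear isomorphism R^d -> L(S) given by the basis of the matrix units
   E_ij with (i, j) allowed. *)
Definition pattern_mx (R : realType) m n (S : pattern m n)
    (v : #|allowed S|.-tuple (measurableTypeR R)) : 'M[R]_(m, n) :=
  \sum_(k < #|allowed S|)
    (tnth v k : R) *: delta_mx (enum_val k).1 (enum_val k).2.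

Lemma respectsP (R : realType) m n (S : pattern m n) (A : 'M[R]_(m, n)) :
  respects S A <->
  exists v : #|allowed S|.-tuple (measurableTypeR R), A = pattern_mx v.
Proof.
split=> [rA|[v ->] i j nS].
  exists [tuple A (enum_val k).1 (enum_val k).2 | k < #|allowed S|].
  rewrite /pattern_mx; under eq_bigr do rewrite tnth_mktuple.
  rewrite -(big_enum_val (A := mem (allowed S))
              (fun p => A p.1 p.2 *: delta_mx p.1 p.2)).
  rewrite {1}[A]matrix_sum_delta pair_big /= [RHS]big_mkcond /=.
  apply: eq_bigr => -[i j] _; rewrite !inE /=.
  by case: ifPn => // nS; rewrite (rA _ _ nS) scale0r.
rewrite summxE big1 // => k _; rewrite !mxE.
have := enum_valP k; rewrite inE; case: (enum_val k) => a b /= Sab.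
case: (eqVneq i a) => [ia|] /=; last by rewrite mulr0.
case: (eqVneq j b) => [jb|]; last by rewrite mulr0.
by move: nS; rewrite ia jb Sab.
Qed.

Definition almost_every (R : realType) m n (S : pattern m n)
    (P : 'M[R]_(m, n) -> Prop) : Prop :=
  {ae @lebesgue_tuple R #|allowed S|, forall v, P (pattern_mx v)}.

Definition kernel_node (R : realType) m n (S : pattern m n) (j : 'I_n) : Prop :=
  almost_every S (fun A : 'M[R]_(m, n) =>
    exists2 x : 'cV[R]_n, A *m x = 0 & x j 0 != 0).

End Patterns.

Section Graphs.
Context {P : nat}.
Implicit Types (e : rel 'I_P) (B C : {set 'I_P}).

(* e j i means that there is an edge from j to i. *)

Definition function_nodes e : {set 'I_P} := [set i | [exists j, e j i]].
Definition variable_nodes e : {set 'I_P} := [set j | [exists i, e j i]].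

Definition backward_set e B : {set 'I_P} :=
  [set g | [exists b in B, e g b]].

(* p is the pair (bottle, neck). *)
Definition backward_Kbottleneck e (K : nat) (p : {set 'I_P} * {set 'I_P}) :=
  [/\ (0 < K)%N, p.1 \subset function_nodes e, p.2 = backward_set e p.1
    & #|p.1| = (#|p.2| + K)%N].

Definition backward_bottleneck e (p : {set 'I_P} * {set 'I_P}) :=
  exists K, backward_Kbottleneck e K p.

Definition is_Kmax e (Kmax : nat) :=
  (exists p, backward_Kbottleneck e Kmax p) /\
  (forall K p, backward_Kbottleneck e K p -> (K <= Kmax)%N).

Definition minimax_backward_bottleneck e (p : {set 'I_P} * {set 'I_P}) :=
  exists Kmax, [/\ is_Kmax e Kmax, backward_Kbottleneck e Kmax p
    & forall q, backward_Kbottleneck e Kmax q -> (#|p.1| <= #|q.1|)%N].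

End Graphs.

(* Nodes are numbered from 0: node i of the text is the ordinal i - 1. *)
Definition equation_node M N (i : 'I_M) : 'I_(maxn M N) :=
  widen_ord (leq_maxl M N) i.
Definition unknown_node M N (j : 'I_N) : 'I_(maxn M N) :=
  widen_ord (leq_maxr M N) j.

Definition structured_system_graph M N (e : rel 'I_(maxn M N)) : Prop :=
  [/\ forall i, (i \in function_nodes e) || (i \in variable_nodes e),
      forall i, (i \in function_nodes e) = (i < M)%N
    & forall j, (j \in variable_nodes e) = (j < N)%N].

Definition structure_matrix M N (e : rel 'I_(maxn M N)) : 'M[bool]_(M, N) :=
  \matrix_(i < M, j < N) e (unknown_node M j) (equation_node N i).

Definition fragile (R : realType) M N (e : rel 'I_(maxn M N)) : Prop :=
  (maxrank R (structure_matrix e) < M)%N.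

(* The kernel nodes of the transposed structure matrix, as nodes of the graph. *)
Definition B_kernel (R : realType) M N (e : rel 'I_(maxn M N)) :
    {set 'I_(maxn M N)} :=
  [set equation_node N i | i : 'I_M
     & `[< kernel_node R (structure_matrix e)^T i >]].

(* Main.v *)
Require Import Defs.
From HB Require Import structures.
From mathcomp Require Import all_boot all_order all_algebra.
From mathcomp Require Import boolp classical_sets reals.
From mathcomp Require Import functions set_interval finmap cardinality.
From mathcomp Require Import ereal measure measurable_realfun.
From mathcomp Require Import lebesgue_measure lebesgue_integral.
From mathcomp Require Import ring zify.

(** A set [B] of equations involves only the variables in its neighbours, so
    the rows of a matrix in [B] have rank at most the number of neighbours, and
    at least [#|B| - #|neighbors S B|] independent left kernel vectors are
    supported in [B].  Hence the deficiency [#|B| - #|neighbors S B|] never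
    exceeds the dimension [M - r] of the left kernel of a matrix of maximal
    rank ([deficiency_le]), and if it reaches [M - r] then [B] supports the
    whole left kernel, so it contains every kernel node
    ([kernel_nodes_sub_max_bottle]).

    Conversely the set [K] of kernel nodes of the transposed pattern has
    deficiency exactly [M - r] ([deficiency_kernel_nodes]).  The left kernel of
    a generic matrix [A] is supported in [K], which gives the rows in [K] rank
    [#|K| - (M - r)]; it remains to see that their nonzero columns, those of
    [neighbors S K], are independent.  If [y] were a dependency with [y_j] not
    zero, pick an allowed entry [(i, j)] with [i] in [K] and a left kernel
    vector [x] with [x_i] not zero: as [x_i * y_j] is not zero, adding 1 to
    the entry [(i, j)] increases the rank of the rows in [K]
    ([rank_perturb]), although that rank is maximal for a generic matrix.
    So [K] is a set of maximal deficiency contained in all the others, i.e. the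
    unique minimax bottle.  This replaces the Hall-Koenig theorem on matchings.

    The word generic is justified by [almost_every_rank_ge]: a rank reached by
    one matrix respecting the pattern is reached by almost all of them, since a
    polynomial that is not identically zero vanishes on a null set only
    ([polynomial_zeros_null]).  Generic ranks also explain why being a kernel
    node is detected on one matrix of maximal rank ([kernel_node_of_max]).
    The theorem follows by reading sets of equations as sets of nodes. *)

Set Implicit Arguments.
Unset Strict Implicit.
Unset Printing Implicit Defensive.

Import Order.TTheory GRing.Theory Num.Theory.
Local Open Scope ring_scope.

(** * Zero sets of polynomial functions *)

(** Polynomial functions of [n] variables are used only through their
    restrictions to lines: this is immediate for determinants, stable under
    fixing a variable, and enough for the null set argument. *)
Definition polynomial_on_lines (R : realType) n
    (f : n.-tuple (measurableTypeR R) -> R) :=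
  forall u w : n.-tuple (measurableTypeR R), exists p : {poly R},
  forall s : R, f [tuple (tnth u i : R) + s * (tnth w i : R) | i < n] = p.[s].

Lemma polynomial_on_lines_section (R : realType) n
    (f : n.+1.-tuple (measurableTypeR R) -> R) (x : measurableTypeR R) :
  polynomial_on_lines f -> polynomial_on_lines (fun t => f (tuple_cons (x, t))).
Proof.
move=> pf u w; have [p fp] := pf (tuple_cons (x, u)) (tuple_cons (0 : R, w)).
exists p => s; rewrite -fp; congr f; apply: eq_from_tnth => i.
rewrite tnth_mktuple; case: (unliftP ord0 i) => [j ->|->].
  by rewrite !tnthS tnth_mktuple.
by rewrite !tnth0 mulr0 addr0.
Qed.

(** Moving the first coordinate alone moves along a line, where a nonzero
    polynomial has finitely many roots. *)
Lemma countable_zeros_first_coordinate (R : realType) n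
    (f : n.+1.-tuple (measurableTypeR R) -> R) t :
  polynomial_on_lines f -> (exists x, f (tuple_cons (x, t)) != 0) ->
  countable [set x | f (tuple_cons (x, t)) = 0]%classic.
Proof.
move=> pf [x0 fx0].
have [p fp] := pf (tuple_cons (0 : R, t))
                  (tuple_cons (1 : R, [tuple (0 : R) | i < n])).
have fE x : f (tuple_cons (x, t)) = p.[x].
  rewrite -fp; congr f; apply: eq_from_tnth => i.
  rewrite tnth_mktuple; case: (unliftP ord0 i) => [j ->|->].
    by rewrite !tnthS tnth_mktuple mulr0 addr0.
  by rewrite !tnth0 mulr1 add0r.
have p0 : p != 0 by apply: contraNneq fx0 => p0; rewrite fE p0 horner0.
apply: finite_set_countable.
apply: contrapT => /infinite_set_fset - /(_ (size p)) [B BD sB].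
have rB : all (root p) B.
  by apply/allP => x /BD /= fx; rewrite /root -fE fx.
have /= := @max_poly_roots _ p B p0 rB (fset_uniq B).
by rewrite ltnNge sB.
Qed.

(** Induction on the number of variables with Tonelli's theorem.  If [f] does
    not vanish at [t0], then for all but countably many values of the first
    coordinate it does not vanish when the others are those of [t0], so the
    induction hypothesis makes the section of the zero set null. *)
Lemma polynomial_zeros_null (R : realType) n
    (f : n.-tuple (measurableTypeR R) -> R) :
  measurable_fun setT f -> polynomial_on_lines f -> (exists t, f t != 0) ->
  @lebesgue_tuple R n [set t | f t = 0]%classic = 0%E.
Proof.
elim: n f => [|n IHn] f mf pf [t0 ft0].
  rewrite /= diracE memNset// => /= f0.
  by move: ft0; rewrite (tuple0 t0) f0 eqxx.
have mfcons : measurable_fun setT (f \o @tuple_cons R n).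
  by apply: measurableT_comp => //; exact: measurable_tuple_cons.
rewrite /= /lebesgue_cons /pushforward /product_measure1.
(* The first coordinates whose section may fail to be null. *)
pose D := [set x : measurableTypeR R |
  f (tuple_cons (x, [tuple of behead t0])) = 0]%classic.
have cD : countable D.
  apply: countable_zeros_first_coordinate => //.
  exists (thead t0); rewrite (_ : tuple_cons _ = t0)//.
  by apply: eq_from_tnth => i; rewrite [in RHS](tuple_eta t0).
have D0 : lebesgue_measure D = 0%E by exact: countable_lebesgue_measure0.
have mD : measurable D by exact: countable_measurable.
rewrite (ge0_negligible_integral mD)//.
- rewrite (eq_integral (cst 0%E)) ?integral0// => x /set_mem /= [_ Dx].
  rewrite xsectionE; apply: IHn (polynomial_on_lines_section x pf) _.
    by apply: (measurableT_comp (f := f \o @tuple_cons R n)) => //.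
  by exists [tuple of behead t0]; apply/eqP.
- apply: measurable_fun_xsection; rewrite -[X in measurable X]setTI.
  exact: (mfcons measurableT [set 0%R]%classic (measurable_set1 _)).
Qed.

Lemma measurable_det (R : realType) d (T : measurableType d) k
    (A : T -> 'M[R]_k) :
  (forall i j, measurable_fun setT (fun t => A t i j)) ->
  measurable_fun setT (fun t => \det (A t)).
Proof.
move=> mA; apply: measurable_sum => s.
by apply: measurable_funM => //; apply: measurable_prod => i _; exact: mA.
Qed.

(** * Generic ranks *)

Lemma pattern_mx_coord (R : realType) m n (S : 'M[bool]_(m, n))
    (v : #|allowed S|.-tuple (measurableTypeR R)) i j :
  pattern_mx v i j = \sum_(k < #|allowed S|)
    (tnth v k : R) * (@delta_mx R m n (enum_val k).1 (enum_val k).2) i j.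
Proof. by rewrite summxE; apply: eq_bigr => k _; rewrite mxE. Qed.

Lemma pattern_mx_line (R : realType) m n (S : 'M[bool]_(m, n))
    (u w : #|allowed S|.-tuple (measurableTypeR R)) (s : R) :
  pattern_mx [tuple (tnth u i : R) + s * (tnth w i : R) | i < #|allowed S|]
    = pattern_mx u + s *: pattern_mx w.
Proof.
rewrite /pattern_mx scaler_sumr -big_split; apply: eq_bigr => k _ /=.
by rewrite tnth_mktuple scalerDl scalerA.
Qed.

Lemma respects_pattern_mx (R : realType) m n (S : 'M[bool]_(m, n))
    (v : #|allowed S|.-tuple (measurableTypeR R)) :
  respects S (pattern_mx v).
Proof. by apply/respectsP; exists v. Qed.

(** Along a line, the matrix is the evaluation of a pencil of matrices whose
    determinant is a univariate polynomial. *)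
Lemma det_polynomial_on_lines (R : realType) m n (S : 'M[bool]_(m, n)) k
    (L : 'M[R]_(k, m)) (Q : 'M[R]_(n, k)) :
  polynomial_on_lines
    (fun v : #|allowed S|.-tuple _ => \det (L *m pattern_mx v *m Q)).
Proof.
move=> u w.
exists (\det (map_mx polyC (L *m pattern_mx u *m Q)
              + 'X *: map_mx polyC (L *m pattern_mx w *m Q))) => s.
rewrite pattern_mx_line -horner_evalE -det_map_mx; congr (\det _).
rewrite mulmxDr mulmxDl -scalemxAr -scalemxAl.
by apply/matrixP => i j; rewrite !mxE /= /horner_eval !hornerE; ring.
Qed.

#[local] Instance almost_every_filter (R : realType) m n (S : 'M[bool]_(m, n)) :
  Filter (@almost_every R m n S).
Proof. exact: fmap_filter. Qed.

Lemma almost_everyS (R : realType) m n (S : 'M[bool]_(m, n))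
    (P Q : 'M[R]_(m, n) -> Prop) :
  (forall A, respects S A -> P A -> Q A) ->
  almost_every S P -> almost_every S Q.
Proof.
move=> PQ; rewrite /almost_every; apply: filterS => v.
by apply: PQ; exact: respects_pattern_mx.
Qed.

Lemma almost_every_det_neq0 (R : realType) m n (S : 'M[bool]_(m, n)) k
    (L : 'M[R]_(k, m)) (Q : 'M[R]_(n, k)) (A0 : 'M[R]_(m, n)) :
  respects S A0 -> \det (L *m A0 *m Q) != 0 ->
  almost_every S (fun A : 'M[R]_(m, n) => \det (L *m A *m Q) != 0).
Proof.
move=> /respectsP[v0 ->] nz.
have mf : measurable_fun setT
    (fun v : #|allowed S|.-tuple _ => \det (L *m pattern_mx v *m Q)).
  apply: measurable_det => i j.
  under eq_fun => v do rewrite mxE.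
  apply: measurable_sum => a; apply: measurable_funM => //.
  under eq_fun => v do rewrite mxE.
  apply: measurable_sum => b; apply: measurable_funM => //.
  under eq_fun => v do rewrite pattern_mx_coord.
  apply: measurable_sum => c; apply: measurable_funM => //.
  exact: measurable_tnth.
exists [set v : #|allowed S|.-tuple _ |
  \det (L *m pattern_mx v *m Q) = 0]%classic.
split.
- rewrite -[X in measurable X]setTI.
  exact: (mf measurableT [set 0]%classic (measurable_set1 _)).
- apply: polynomial_zeros_null => //; first exact: det_polynomial_on_lines.
  by exists v0.
- by move=> v /= /negP/negPn/eqP.
Qed.

(** The converse of the fact that [L *m A *m Q] has rank at most [\rank A]: a
    rank is witnessed by one nonzero determinant, without choosing a minor. *)
Lemma rank_certificate (F : fieldType) m n (A : 'M[F]_(m, n)) :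
  exists (L : 'M[F]_(\rank A, m)) (Q : 'M[F]_(n, \rank A)), L *m A *m Q = 1%:M.
Proof.
exists (pinvmx (col_base A)), (pinvmx (row_base A)).
rewrite -[X in _ *m X *m _ = _](mulmx_base A) mulmxA.
by rewrite mulVpmx ?col_base_full// mul1mx mulmxVp ?row_base_free.
Qed.

(** The certificate of the rank of [A0 *m Q] is a determinant that does not
    vanish at [A0], hence vanishes almost nowhere. *)
Lemma almost_every_rank_ge (R : realType) m n (S : 'M[bool]_(m, n)) p
    (Q : 'M[R]_(n, p)) (A0 : 'M[R]_(m, n)) :
  respects S A0 ->
  almost_every S
    (fun A : 'M[R]_(m, n) => (\rank (A0 *m Q) <= \rank (A *m Q))%N).
Proof.
move=> rA0; have [L [C LC]] := rank_certificate (A0 *m Q).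
have : almost_every S (fun A : 'M[R]_(m, n) => \det (L *m A *m (Q *m C)) != 0).
  apply: (almost_every_det_neq0 rA0).
  by rewrite -!mulmxA in LC *; rewrite LC det1 oner_neq0.
apply: almost_everyS => A _; rewrite -unitfE -unitmxE => /mxrank_unit {1}<-.
rewrite mulmxA -(mulmxA L); apply: leq_trans (mxrankM_maxl _ _) _.
exact: mxrankM_maxr.
Qed.

(** The whole space is a box with sides of infinite length, so it is not null. *)
Lemma almost_every_ex (R : realType) m n (S : 'M[bool]_(m, n))
    (P : 'M[R]_(m, n) -> Prop) :
  almost_every S P -> exists2 A, respects S A & P A.
Proof.
move=> aeP; apply: contrapT => nP.
have : (@lebesgue_tuple R #|allowed S|).-negligible setT.
  apply: negligibleS aeP => v _ /= Pv; apply: nP.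
  by exists (pattern_mx v) => //; exact: respects_pattern_mx.
case=> N [mN N0 TN].
have NT : N = setT by apply/seteqP; split.
have := @lebesgue_tuple_box R #|allowed S| (fun=> setT) (fun=> measurableT).
rewrite (_ : mkset _ = N) ?N0; last by rewrite NT; apply/seteqP; split.
apply/eqP; rewrite eq_sym; elim/big_ind: _ => [||i _].
- by rewrite oner_neq0.
- by move=> x y; rewrite mule_eq0 negb_or => -> ->.
- by rewrite -set_itvNyy; have /= -> := @lebesgue_measure_itv R `]-oo, +oo[.
Qed.

(** * Bottles, kernel vectors and maximal rank *)

Definition neighbors m n (S : 'M[bool]_(m, n)) (B : {set 'I_m}) : {set 'I_n} :=
  [set j | [exists i in B, S i j]].

(** Multiplying by it on the left keeps the rows in [B]; its row space consists
    of the vectors supported in [B]. *)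
Definition selection_mx (F : fieldType) m (B : {set 'I_m}) : 'M[F]_(#|B|, m) :=
  rowsub enum_val 1%:M.

Lemma mul_selection_mx (F : fieldType) m n (B : {set 'I_m}) (A : 'M[F]_(m, n)) :
  selection_mx F B *m A = rowsub enum_val A.
Proof. by rewrite mul_rowsub_mx mul1mx. Qed.

Lemma rank_selection_mx (F : fieldType) m (B : {set 'I_m}) :
  \rank (selection_mx F B) = #|B|.
Proof.
apply/eqP/row_freeP; exists (selection_mx F B)^T.
rewrite mul_selection_mx; apply/matrixP => i j.
by rewrite !mxE (inj_eq enum_val_inj) eq_sym.
Qed.

Lemma sub_selection_mxP (F : fieldType) m p (B : {set 'I_m}) (X : 'M[F]_(p, m)) :
  reflect (forall k i, i \notin B -> X k i = 0) (X <= selection_mx F B)%MS.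
Proof.
apply: (iffP submxP) => [[Y ->] k i iB|X0].
  rewrite mxE big1 // => l _; rewrite !mxE.
  case: eqP iB => [<-|_ _]; last by rewrite mulr0.
  by rewrite enum_valP.
exists (colsub enum_val X); apply/matrixP => k i; rewrite mxE.
case: (boolP (i \in B)) => [iB|iB]; last first.
  rewrite X0// big1// => l _; rewrite !mxE.
  case: eqP iB => [<-|_ _]; last by rewrite mulr0.
  by rewrite enum_valP.
rewrite (bigD1 (enum_rank_in iB i))//= !mxE enum_rankK_in// eqxx mulr1.
rewrite big1 ?addr0// => l li; rewrite !mxE.
case: (eqVneq (enum_val l) i) => [eli|_]; last by rewrite mulr0.
by case/eqP: li; rewrite -[l in LHS](enum_valK_in iB) eli.
Qed.

(** The rows in [B] are supported in the neighbours of [B]. *)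
Lemma rank_selection_mul_le (R : realType) m n (S : 'M[bool]_(m, n))
    (B : {set 'I_m}) (A : 'M[R]_(m, n)) :
  respects S A -> (\rank (selection_mx R B *m A) <= #|neighbors S B|)%N.
Proof.
move=> rA; rewrite -(rank_selection_mx R (neighbors S B)) mxrankS//.
apply/sub_selection_mxP => k j jB; rewrite mul_selection_mx mxE.
apply: rA; apply: contra jB => Sij; rewrite inE; apply/existsP.
by exists (enum_val k); rewrite enum_valP.
Qed.

(** Rank-nullity for the rows in [B]: their dependencies are the left kernel
    vectors of [A] supported in [B]. *)
Lemma rank_kernel_in_bottle (R : realType) m n (S : 'M[bool]_(m, n))
    (B : {set 'I_m}) (A : 'M[R]_(m, n)) :
  respects S A ->
  (#|B| <= #|neighbors S B| + \rank (selection_mx R B :&: kermx A)%MS)%N.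
Proof.
move=> rA; rewrite -[X in (X <= _)%N](rank_selection_mx R B).
by rewrite -(mxrank_mul_ker (selection_mx R B) A) leq_add2r rank_selection_mul_le.
Qed.

Lemma respects0 (R : realType) m n (S : 'M[bool]_(m, n)) :
  respects S (0 : 'M[R]_(m, n)).
Proof. by move=> i j _; rewrite mxE. Qed.

Lemma respects_tr (R : realType) m n (S : 'M[bool]_(m, n)) (A : 'M[R]_(m, n)) :
  respects S A -> respects S^T A^T.
Proof. by move=> rA i j; rewrite !mxE; exact: rA. Qed.

Lemma rank_le_maxrank (R : realType) m n (S : 'M[bool]_(m, n))
    (A : 'M[R]_(m, n)) :
  respects S A -> (\rank A <= maxrank R S)%N.
Proof.
move=> rA; have lt : (\rank A < m.+1)%N by rewrite ltnS rank_leq_row.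
rewrite /maxrank (bigD1 (Ordinal lt)) ?leq_maxl//=.
by apply/asboolP; exists A.
Qed.

Lemma maxrank_attained (R : realType) m n (S : 'M[bool]_(m, n)) :
  exists2 A : 'M[R]_(m, n), respects S A & \rank A = maxrank R S.
Proof.
rewrite /maxrank; elim/big_ind: _ => [|x y [A rA <-] [B rB <-]|k /asboolP//].
  by exists 0; [exact: respects0|rewrite mxrank0].
by case/orP: (leq_total (\rank A) (\rank B)) => [/maxn_idPr|/maxn_idPl] ->;
  [exists B|exists A].
Qed.

Lemma maxrank_tr_le (R : realType) m n (S : 'M[bool]_(m, n)) :
  (maxrank R S <= maxrank R S^T)%N.
Proof.
have [A rA <-] := maxrank_attained R S.
by rewrite -mxrank_tr rank_le_maxrank//; exact: respects_tr.
Qed.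

Lemma maxrank_tr (R : realType) m n (S : 'M[bool]_(m, n)) :
  maxrank R S^T = maxrank R S.
Proof.
apply/eqP; rewrite eqn_leq maxrank_tr_le andbT.
by rewrite -[X in (_ <= maxrank R X)%N]trmxK maxrank_tr_le.
Qed.

(** The left kernel vectors supported in [B] are too few for a deficiency larger
    than the dimension of the left kernel. *)
Lemma deficiency_le (R : realType) m n (S : 'M[bool]_(m, n)) (B : {set 'I_m}) :
  (#|B| <= #|neighbors S B| + (m - maxrank R S))%N.
Proof.
have [A rA <-] := maxrank_attained R S.
apply: leq_trans (rank_kernel_in_bottle B rA) _.
by rewrite leq_add2l -mxrank_ker mxrankS ?capmxSr.
Qed.

(** When the deficiency is maximal, the left kernel vectors supported in [B]
    fill the left kernel for reasons of dimension. *)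
Lemma kernel_sub_max_bottle (R : realType) m n (S : 'M[bool]_(m, n))
    (B : {set 'I_m}) (A : 'M[R]_(m, n)) :
  respects S A -> \rank A = maxrank R S ->
  #|B| = (#|neighbors S B| + (m - maxrank R S))%N ->
  (kermx A <= selection_mx R B)%MS.
Proof.
move=> rA rkA dB; apply: submx_trans (capmxSl _ (kermx A)).
rewrite -(mxrank_leqif_sup (capmxSr _ _)) eqn_leq mxrankS ?capmxSr//=.
by rewrite mxrank_ker rkA -(leq_add2l #|neighbors S B|) -dB rank_kernel_in_bottle.
Qed.

Lemma almost_every_tr_rank_ge (R : realType) m n (S : 'M[bool]_(m, n)) p
    (L : 'M[R]_(p, m)) (A0 : 'M[R]_(m, n)) :
  respects S A0 ->
  almost_every S^T
    (fun A : 'M[R]_(n, m) => (\rank (L *m A0) <= \rank (L *m A^T))%N).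
Proof.
move=> /respects_tr/(almost_every_rank_ge L^T).
apply: almost_everyS => A _.
by rewrite -trmx_mul mxrank_tr -(mxrank_tr (_ *m L^T)) trmx_mul trmxK.
Qed.

Lemma kermx_coord0P (F : fieldType) m n (A : 'M[F]_(m, n)) (i : 'I_m) :
  reflect (forall x : 'rV_m, x *m A = 0 -> x 0 i = 0)
          (kermx A <= selection_mx F [set~ i])%MS.
Proof.
apply: (iffP idP) => [kA x xA0|H].
  have /sub_selection_mxP : (x <= selection_mx F [set~ i])%MS.
    by apply: submx_trans kA; apply/sub_kermxP.
  by apply; rewrite !inE negbK.
apply/sub_selection_mxP => k j; rewrite !inE negbK => /eqP->.
have := H (row k (kermx A)); rewrite mxE; apply.
by apply/sub_kermxP; exact: row_sub.
Qed.

(** By rank-nullity.  This turns the existence of a kernel vector through [i]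
    into a comparison of ranks, to which genericity applies. *)
Lemma rank_drop_row (F : fieldType) m n (A : 'M[F]_(m, n)) (i : 'I_m) :
  (kermx A <= selection_mx F [set~ i])%MS
  = (\rank (selection_mx F [set~ i] *m A) < \rank A)%N.
Proof.
have := mxrank_mul_ker (selection_mx F [set~ i]) A.
have : \rank (selection_mx F [set~ i]) = m.-1.
  by rewrite rank_selection_mx cardsC1 card_ord.
have -> : (kermx A <= selection_mx F [set~ i])%MS
    = (\rank (kermx A) == \rank (selection_mx F [set~ i] :&: kermx A)%MS)%N.
  by rewrite eq_sym (mxrank_leqif_sup (capmxSr _ _)) sub_capmx submx_refl andbT.
have := mxrankS (capmxSr (selection_mx F [set~ i]) (kermx A)).
have := ltn_ord i; have := rank_leq_row A; rewrite mxrank_ker.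
by move=> *; apply/idP/idP; lia.
Qed.

(** For [A], deleting row [i] does not lower the rank; as a generic matrix does
    at least as well after the deletion, and no better before it, deleting row
    [i] does not lower its rank either. *)
Lemma kernel_node_of_max (R : realType) m n (S : 'M[bool]_(m, n))
    (A : 'M[R]_(m, n)) (x : 'rV_m) i :
  respects S A -> \rank A = maxrank R S -> x *m A = 0 -> x 0 i != 0 ->
  kernel_node R S^T i.
Proof.
move=> rA rkA xA xi.
have : almost_every S^T (fun A' : 'M[R]_(n, m) =>
    (\rank (selection_mx R [set~ i] *m A) <=
       \rank (selection_mx R [set~ i] *m A'^T))%N).
  exact: almost_every_tr_rank_ge.
apply: almost_everyS => A' respA' le.
have rA' : (\rank A'^T <= \rank A)%N.
  by rewrite rkA rank_le_maxrank// -(trmxK S); exact: respects_tr.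
apply: contrapT => nx.
have : (kermx A'^T <= selection_mx R [set~ i])%MS.
  apply/kermx_coord0P => y yA; apply/eqP; apply: contrapT => /negP yi.
  apply: nx; exists y^T; last by rewrite mxE.
  by rewrite -(trmxK A') -trmx_mul yA trmx0.
rewrite rank_drop_row => lt.
have := leq_trans (leq_ltn_trans le lt) rA'; rewrite -rank_drop_row.
by move=> /kermx_coord0P/(_ _ xA)/eqP; exact/negP.
Qed.

Lemma almost_every_tr_ex (R : realType) m n (S : 'M[bool]_(m, n))
    (P : 'M[R]_(n, m) -> Prop) :
  almost_every S^T P -> exists2 A : 'M[R]_(m, n), respects S A & P A^T.
Proof.
move=> /almost_every_ex[A rA PA]; exists A^T; last by rewrite trmxK.
by rewrite -(trmxK S); exact: respects_tr.
Qed.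

Definition kernel_nodes (R : realType) m n (S : 'M[bool]_(m, n)) : {set 'I_m} :=
  [set i | `[< kernel_node R S^T i >]].

(** A generic matrix has both maximal rank and, for the kernel node at hand, a
    kernel vector through it; that vector is supported in [B]. *)
Lemma kernel_nodes_sub_max_bottle (R : realType) m n (S : 'M[bool]_(m, n))
    (B : {set 'I_m}) :
  #|B| = (#|neighbors S B| + (m - maxrank R S))%N -> kernel_nodes R S \subset B.
Proof.
move=> dB; apply/fintype.subsetP => i; rewrite inE => /asboolP ki.
have [A0 rA0 rkA0] := maxrank_attained R S.
have aer := almost_every_tr_rank_ge 1%:M rA0.
have [A rA [[x xA xi]]] := almost_every_tr_ex (filterI ki aer).
rewrite !mul1mx trmxK rkA0 => leA.
have rkA : \rank A = maxrank R S.
  by apply/eqP; rewrite eqn_leq leA rank_le_maxrank.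
have kA := kernel_sub_max_bottle rA rkA dB.
have /sub_selection_mxP xB : (x^T <= selection_mx R B)%MS.
  apply: submx_trans kA; apply/sub_kermxP.
  by rewrite -[A]trmxK -trmx_mul xA trmx0.
by apply: contraNT xi => /(xB 0); rewrite mxE => ->.
Qed.

(** A rank-one perturbation raises the rank as soon as it pairs nontrivially
    with the left and right kernels: multiplying by [x] shows that the new row
    space contains [w], hence the old rows, while [y] separates [w] from the
    old row space. *)
Lemma rank_perturb (F : fieldType) p n (B : 'M[F]_(p, n)) (x : 'rV_p)
    (y : 'cV_n) (u : 'cV_p) (w : 'rV_n) :
  x *m B = 0 -> B *m y = 0 -> x *m u != 0 -> w *m y != 0 ->
  (\rank B < \rank (B + u *m w)%R)%N.
Proof.
move=> xB By xu wy.
set C := B + u *m w.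
have wC : (w <= C)%MS.
  have xC : x *m C = (x *m u) 0 0 *: w.
    by rewrite mulmxDr xB add0r mulmxA {1}[x *m u]mx11_scalar mul_scalar_mx.
  have xu0 : (x *m u) 0 0 != 0.
    by apply: contraNneq xu => xu0; rewrite [x *m u]mx11_scalar xu0 raddf0.
  by rewrite -(eqmx_scale w xu0) -xC submxMl.
have BC : (C - u *m w <= C)%MS.
  by rewrite addmx_sub// -mulNmx (submx_trans _ wC)// submxMl.
rewrite {1}/C addrK in BC.
apply: rank_ltmx; rewrite ltmxE BC /=.
apply/negP => CB; have /submxP[z wz] := submx_trans wC CB.
by move: wy; rewrite wz -mulmxA By mulmx0 eqxx.
Qed.

(** Rank-nullity for the columns in [C], read on the transpose. *)
Lemma column_dependency (F : fieldType) p n (B : 'M[F]_(p, n)) (C : {set 'I_n}) :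
  (\rank B < #|C|)%N ->
  exists2 y : 'cV_n, B *m y = 0 & exists2 j, j \in C & y j 0 != 0.
Proof.
move=> lt.
have : (\rank (selection_mx F C :&: kermx B^T)%MS != 0)%N.
  have := mxrank_mul_ker (selection_mx F C) B^T.
  have := mxrankM_maxr (selection_mx F C) B^T.
  rewrite rank_selection_mx mxrank_tr.
  case: (\rank (_ :&: _)%MS) => // leB; rewrite addn0 => E.
  by move: lt; rewrite -E ltnNge leB.
rewrite mxrank_eq0 => /rowV0Pn[v]; rewrite sub_capmx.
move=> /andP[vC /sub_kermxP vB] /rV0Pn[j vj].
exists v^T; first by rewrite -(trmxK B) -trmx_mul vB trmx0.
exists j; last by rewrite mxE.
by apply: contraNT vj => /(sub_selection_mxP _ _ vC) ->.
Qed.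

Lemma kermx_sub_kernel_nodes (R : realType) m n (S : 'M[bool]_(m, n))
    (A : 'M[R]_(m, n)) :
  respects S A -> \rank A = maxrank R S ->
  (kermx A <= selection_mx R (kernel_nodes R S))%MS.
Proof.
move=> rA rkA; apply/sub_selection_mxP => k i; rewrite inE => /asboolP nki.
apply/eqP; apply: contrapT => /negP xi; apply: nki.
apply: (@kernel_node_of_max _ _ _ _ A (row k (kermx A))) => //.
  by apply/sub_kermxP; exact: row_sub.
by rewrite mxE.
Qed.

(** Rank-nullity for the rows of the kernel nodes, which carry the whole left
    kernel. *)
Lemma rank_selection_kernel_nodes (R : realType) m n (S : 'M[bool]_(m, n))
    (A : 'M[R]_(m, n)) :
  respects S A -> \rank A = maxrank R S ->
  (\rank (selection_mx R (kernel_nodes R S) *m A) + (m - maxrank R S)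
   = #|kernel_nodes R S|)%N.
Proof.
move=> rA rkA.
have kA := kermx_sub_kernel_nodes rA rkA.
rewrite -[RHS](rank_selection_mx R) -(mxrank_mul_ker _ A) -rkA -mxrank_ker.
congr (_ + _)%N; apply: eqmx_rank.
by rewrite sub_capmx kA submx_refl /= capmxSr.
Qed.

Lemma respects_add_delta (R : realType) m n (S : 'M[bool]_(m, n))
    (A : 'M[R]_(m, n)) i j :
  respects S A -> S i j -> respects S (A + delta_mx i j).
Proof.
move=> rA Sij a b nS; rewrite !mxE rA//.
case: eqP => [ai|]; case: eqP => [bj|]; rewrite ?addr0//.
by move: nS; rewrite ai bj Sij.
Qed.

(** The neighbours of the kernel nodes are columns that a generic matrix makes
    independent on the rows of the kernel nodes: otherwise one allowed entry
    could be perturbed to increase a rank that is already maximal. *)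
Lemma deficiency_kernel_nodes (R : realType) m n (S : 'M[bool]_(m, n)) :
  #|kernel_nodes R S|
    = (#|neighbors S (kernel_nodes R S)| + (m - maxrank R S))%N.
Proof.
set K := kernel_nodes R S; set E := selection_mx R K.
have [A0 rA0 rkA0] := maxrank_attained R S.
have [A1 rA1 A1max] : exists2 A1 : 'M[R]_(m, n), respects S A1 &
    forall A, respects S A -> (\rank (E *m A) <= \rank (E *m A1))%N.
  pose Q k := `[< exists2 A : 'M[R]_(m, n), respects S A & \rank (E *m A) = k >].
  have exQ : exists k, Q k.
    exists (\rank (E *m (0 : 'M[R]_(m, n)))); apply/asboolP.
    by exists 0 => //; exact: respects0.
  have ubQ k : Q k -> (k <= #|K|)%N.
    by move=> /asboolP[A _ <-]; exact: rank_leq_row.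
  case: (ex_maxnP exQ ubQ) => k /asboolP[A1 rA1 <-] kmax.
  by exists A1 => // A rA; apply: kmax; apply/asboolP; exists A.
pose hit i (A : 'M[R]_(n, m)) :=
  i \in K -> exists2 x : 'cV_m, A *m x = 0 & x i 0 != 0.
(* A common [A] is needed for all the kernel nodes, since the entry to perturb
   is known only once [A] is chosen. *)
have aeK : almost_every S^T (fun A => forall i, hit i A).
  apply: (@filter_forall _ _ hit (almost_every S^T)) => i; rewrite /hit.
  case: (boolP (i \in K)) => iK; last exact: filterE.
  move: (iK); rewrite inE => /asboolP; exact: filterS.
have [A rA [[]]] := almost_every_tr_ex (filterI (filterI
  (almost_every_tr_rank_ge 1%:M rA0) (almost_every_tr_rank_ge E rA1)) aeK).
rewrite !mul1mx !trmxK rkA0 => leA EA1 kerA.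
have rkA : \rank A = maxrank R S.
  by apply/eqP; rewrite eqn_leq leA rank_le_maxrank.
rewrite -(rank_selection_kernel_nodes rA rkA) -/K -/E; congr (_ + _)%N.
apply/eqP; rewrite eqn_leq rank_selection_mul_le//= leqNgt; apply/negP => lt.
have [y EAy [j]] := column_dependency lt.
rewrite inE => /existsP[i /andP[iK Sij]] yj.
have [x xA xi] := kerA _ iK.
have := A1max _ (respects_add_delta rA Sij); apply/negP; rewrite -ltnNge.
apply: leq_ltn_trans EA1 _; rewrite mulmxDr.
rewrite -(mul_delta_mx (0 : 'I_1)) mulmxA.
have xAT : x^T *m A = 0 by rewrite -[A]trmxK -trmx_mul xA trmx0.
have /submxP[z xz] : (x^T <= E)%MS.
  by apply: submx_trans (kermx_sub_kernel_nodes rA rkA); apply/sub_kermxP.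
apply: (@rank_perturb _ _ _ _ z y) => //.
- by rewrite mulmxA -xz.
- rewrite mulmxA -xz -colE; apply: contraNneq xi => /matrixP/(_ 0 0).
  by rewrite !mxE => ->.
- rewrite -rowE; apply: contraNneq yj => /matrixP/(_ 0 0).
  by rewrite !mxE => ->.
Qed.

(** * Bottlenecks of the graph *)

Lemma equation_node_inj M N : injective (@equation_node M N).
Proof. by move=> i j /(congr1 val)/= ij; exact: val_inj. Qed.

Lemma unknown_node_inj M N : injective (@unknown_node M N).
Proof. by move=> i j /(congr1 val)/= ij; exact: val_inj. Qed.

(** A node with an edge towards an equation is a variable node, so no node
    beyond the unknowns enters the neck. *)
Lemma backward_set_equations M N (e : rel 'I_(maxn M N)) (B : {set 'I_M}) :
  structured_system_graph e ->
  backward_set e (equation_node N @: B)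
    = @unknown_node M N @: neighbors (structure_matrix e) B.
Proof.
move=> [_ _ hx]; apply/setP => g; rewrite inE; apply/idP/imsetP.
  move=> /existsP[_ /andP[/imsetP[i iB ->] egi]].
  have gN : (g < N)%N.
    by rewrite -hx inE; apply/existsP; exists (equation_node N i).
  have gE : g = unknown_node M (Ordinal gN) by apply: val_inj.
  exists (Ordinal gN) => //; rewrite inE; apply/existsP; exists i.
  by rewrite iB mxE -gE.
move=> [j]; rewrite inE => /existsP[i /andP[iB]]; rewrite mxE => eji ->.
by apply/existsP; exists (equation_node N i); rewrite imset_f.
Qed.

Lemma backward_Kbottleneck_equations M N (e : rel 'I_(maxn M N)) (B : {set 'I_M})
    K :
  structured_system_graph e -> (0 < K)%N ->
  #|B| = (#|neighbors (structure_matrix e) B| + K)%N ->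
  backward_Kbottleneck e K
    (equation_node N @: B, backward_set e (equation_node N @: B)).
Proof.
move=> He K0 dB; have [_ hf _] := He; split=> //=.
  by apply/fintype.subsetP => _ /imsetP[i _ ->]; rewrite hf /=.
rewrite backward_set_equations// !card_imset//.
  exact: unknown_node_inj.
exact: equation_node_inj.
Qed.

Lemma backward_Kbottleneck_inv M N (e : rel 'I_(maxn M N)) K p :
  structured_system_graph e -> backward_Kbottleneck e K p ->
  exists2 B : {set 'I_M},
    p = (equation_node N @: B, backward_set e (equation_node N @: B))
    & #|B| = (#|neighbors (structure_matrix e) B| + K)%N.
Proof.
case: p => [C D] He [/= _ Cf -> cardC]; have [_ hf _] := He.
pose B := [set i : 'I_M | equation_node N i \in C].
have CE : C = equation_node N @: B.
  apply/setP => g; apply/idP/imsetP => [gC|[i + ->]]; last by rewrite inE.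
  have gM : (g < M)%N by rewrite -hf; exact: (fintype.subsetP Cf).
  have gE : g = equation_node N (Ordinal gM) by apply: val_inj.
  by exists (Ordinal gM); rewrite // inE -gE.
exists B; first by rewrite CE.
move: cardC; rewrite CE backward_set_equations// !card_imset//.
  exact: unknown_node_inj.
exact: equation_node_inj.
Qed.

Lemma B_kernelE (R : realType) M N (e : rel 'I_(maxn M N)) :
  B_kernel R e = equation_node N @: kernel_nodes R (structure_matrix e).
Proof.
apply/setP => g; apply/imsetP/imsetP => -[i + ->]; rewrite !inE => ki;
  by exists i; rewrite ?inE.
Qed.

(** The kernel nodes form a bottle of maximal deficiency contained in all the
    others, so having minimum size among these forces equality with it. *)
Lemma minimax_backward_bottleneckP (R : realType) M N (e : rel 'I_(maxn M N)) p :
  structured_system_graph e ->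
  minimax_backward_bottleneck e p <->
  (maxrank R (structure_matrix e) < M)%N /\
  p = (B_kernel R e, backward_set e (B_kernel R e)).
Proof.
move=> He; set S := structure_matrix e.
have dK := deficiency_kernel_nodes R S.
have Kbot : (maxrank R S < M)%N -> backward_Kbottleneck e (M - maxrank R S)
    (B_kernel R e, backward_set e (B_kernel R e)).
  by rewrite -subn_gt0 B_kernelE => r_lt; exact: backward_Kbottleneck_equations.
have Kle K q : backward_Kbottleneck e K q -> (K <= M - maxrank R S)%N.
  move=> /(backward_Kbottleneck_inv He)[B _ dB].
  by rewrite -(leq_add2l #|neighbors S B|) -dB deficiency_le.
have Ksub q : backward_Kbottleneck e (M - maxrank R S) q ->
    B_kernel R e \subset q.1.
  move=> /(backward_Kbottleneck_inv He)[B -> dB] /=.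
  by rewrite B_kernelE imsetS// kernel_nodes_sub_max_bottle.
split=> [[K [[_ Kmax] Kp pmin]]|[r_lt ->]]; last first.
  exists (M - maxrank R S)%N; split; last by move=> q /Ksub/subset_leq_card.
  - by split=> [|K q /Kle//]; eexists; exact: Kbot.
  - exact: Kbot.
have r_lt : (maxrank R S < M)%N.
  by rewrite -subn_gt0 (leq_trans _ (Kle _ _ Kp))//; case: Kp.
split=> //.
have KE : K = (M - maxrank R S)%N.
  by apply/eqP; rewrite eqn_leq (Kle _ _ Kp) (Kmax _ _ (Kbot r_lt)).
rewrite KE in Kp pmin *.
have p1 : B_kernel R e = p.1.
  by apply/eqP; rewrite eqEcard (Ksub _ Kp) (pmin _ (Kbot r_lt)).
by have [_ _ p2 _] := Kp; rewrite p1 -p2; case: (p).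
Qed.

Lemma maxrank_lt_iff_backward_Kbottleneck (R : realType) M N
    (e : rel 'I_(maxn M N)) :
  structured_system_graph e ->
  (maxrank R (structure_matrix e) < M)%N <->
  exists K p, (0 < K)%N /\ backward_Kbottleneck e K p.
Proof.
move=> He; split=> [r_lt|[K [p [K0 /(backward_Kbottleneck_inv He)[B _ dB]]]]].
  have r_lt' := r_lt; rewrite -subn_gt0 in r_lt'.
  do 2 eexists; split; first exact: r_lt'.
  exact: (backward_Kbottleneck_equations He r_lt' (deficiency_kernel_nodes R _)).
rewrite -subn_gt0 (leq_trans K0)//.
by rewrite -(leq_add2l #|neighbors (structure_matrix e) B|) -dB deficiency_le.
Qed.

Theorem theorem2 (R : realType) (M N : nat) (e : rel 'I_(maxn M N))
    (He : structured_system_graph e) :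
  let S := structure_matrix e in
  let T := (S^T)%R in
  let r := maxrank R S in
  r = maxrank R T /\
  (* (I) *)
  ((r < M)%N <->
     exists K p, (0 < K)%N /\ backward_Kbottleneck e K p) /\
  ((r < M)%N ->
     (exists! p, minimax_backward_bottleneck e p) /\
     (forall p, minimax_backward_bottleneck e p ->
        backward_Kbottleneck e (M - r) p)) /\
  (* (II) *)
  (forall p, minimax_backward_bottleneck e p -> p.1 = B_kernel R e) /\
  (* (III) *)
  (fragile R e <-> exists p, backward_bottleneck e p).
Proof.
move=> S T r; split; first by rewrite /T maxrank_tr.
have bottleneckP := maxrank_lt_iff_backward_Kbottleneck R He.
have minimaxP p := minimax_backward_bottleneckP R p He.
split=> //; split.
  move=> r_lt; split.
    exists (B_kernel R e, backward_set e (B_kernel R e)); split.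
      by apply/minimaxP.
    by move=> p /minimaxP[].
  move=> p /minimaxP[_ ->]; rewrite B_kernelE.
  apply: backward_Kbottleneck_equations => //; first by rewrite subn_gt0.
  exact: deficiency_kernel_nodes.
split; first by move=> p /minimaxP[_ ->].
rewrite /fragile bottleneckP; split=> [[K [p [_ Kp]]]|[p [K Kp]]].
  by exists p, K.
by exists K, p; split=> //; case: Kp.
Qed.
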